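(* Let $p\ge5$ be a prime and $k$ a positive integer. Then $$M_k(\Gamma(p))=\bigoplus_{r=0}^{p-1}M_{k,r}(\Gamma(p)).$$ In particular, $M_{k,0}(\Gamma(p))=M_k(\Gamma_1(p))$. Moreover, if $(\mathbb{Z}/p\mathbb{Z})^\times=\langle\alpha\rangle$ and $\tilde\alpha$ denotes the inverse of $\alpha$ modulo $p$, then for $r$ such that $\left(\frac rp\right)=1$, $$M_{k,r}(\Gamma(p))\cong M_{k,1}(\Gamma(p)),$$ and for $r$ such that $\left(\frac rp\right)=-1$, $$M_{k,r}(\Gamma(p))\cong M_{k,\tilde\alpha}(\Gamma(p)).$$
   Context: Let $q=e^{2\pi i\tau}$. $M_k(\Gamma)$ is the space of holomorphic modular forms of weight $k$ for $\Gamma$. For $0\le r\le p-1$, $M_{k,r}(\Gamma(p))=\{g\in M_k(\Gamma(p)): g\in q^{r/p}\mathbb{C}[[q]]\}$, the index $r$ being read modulo $p$. $\left(\frac{\cdot}{p}\right)$ is the Legendre symbol, and $\cong$ means isomorphism of complex vector spaces. *)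

(* Defs.v *)
From HB Require Import structures.
From mathcomp Require Import all_boot all_order all_algebra all_fingroup.
From mathcomp Require Import all_classical all_reals all_analysis.
From mathcomp Require Import complex ring lra.

Set Implicit Arguments.
Unset Strict Implicit.
Unset Printing Implicit Defensive.

Import Order.TTheory GRing.Theory Num.Theory numFieldNormedType.Exports.

Local Open Scope classical_set_scope.
Local Open Scope ring_scope.

(* The regular module R[i]^o carries the topology and norm of the field R[i]. *)
Notation Cplx R := (R[i]^o).

Definition upper (R : realType) := {z : R[i] | 0 < complex.Im z}.

Section ModularForms.
Variable R : realType.
Implicit Types (f g : upper R -> Cplx R) (A : 'M[int]_2) (t : upper R).

Definition cexp (z : R[i]) : Cplx R :=
  real_complex R (expR (complex.Re z)) *
  Complex (cos (complex.Im z)) (sin (complex.Im z)).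

(* q^x = e^(2 pi i x t) *)
Definition qpow (x : R) t : Cplx R := cexp (Complex 0 (2 * pi * x) * val t).

Definition autfactor A t : R[i] := (A 1 0)%:~R * val t + (A 1 1)%:~R.

Definition moebius A t : R[i] :=
  ((A 0 0)%:~R * val t + (A 0 1)%:~R) / autfactor A t.

Lemma moebius_upper A t : \det A = 1 -> 0 < complex.Im (moebius A t).
Proof.
rewrite /moebius /autfactor; case: t => -[x y] /= y0 detA.
have intC (n : int) : n%:~R = Complex n%:~R 0 :> R[i].
  by rewrite -(rmorph_int (real_complex R)).
have {}detA : (A 0 0)%:~R * (A 1 1)%:~R - (A 0 1)%:~R * (A 1 0)%:~R = 1 :> R.
  rewrite -!intrM -intrB.
  suff <- : \det A = A 0 0 * A 1 1 - A 0 1 * A 1 0 by rewrite detA.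
  rewrite (expand_det_row _ 0) !big_ord_recl big_ord0 addr0 /cofactor !det_mx11.
  rewrite !mxE /=.
  have -> : lift (0 : 'I_2) 0 = 1 by exact: val_inj.
  have -> : lift (1 : 'I_2) 0 = 0 by exact: val_inj.
  by rewrite /= expr0 expr1 mul1r mulN1r mulrN.
rewrite !intC.
move: detA; set a : R := (A 0 0)%:~R; set b : R := (A 0 1)%:~R.
set c : R := (A 1 0)%:~R; set d : R := (A 1 1)%:~R => detA.
have n0 : 0 < (c * x + d) ^+ 2 + (c * y) ^+ 2.
  rewrite lt0r addr_ge0 ?sqr_ge0// andbT; apply/eqP => /eqP.
  rewrite paddr_eq0 ?sqr_ge0// !sqrf_eq0 mulf_eq0 (gt_eqF y0) orbF.
  by case/andP => /eqP h /eqP c0; move: h detA; rewrite c0 mul0r add0r => ->; nra.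
simpc.
set n := _ ^+ 2 + _ ^+ 2 in n0 *.
rewrite [ltRHS](_ : _ = (a * d - b * c) * y / n); last first.
  by rewrite /=; field; rewrite gt_eqF.
by rewrite detA mul1r divr_gt0.
Qed.

(* By moebius_upper, the default value of insubd is not used for \det A = 1. *)
Definition moebius_act A t : upper R := insubd t (moebius A t).

Definition slash (k : nat) A f : upper R -> Cplx R :=
  fun t => (autfactor A t) ^- k * f (moebius_act A t).

(* Complex differentiability, tested on the extension of f by 0. *)
Definition holomorphic f :=
  forall t, derivable
    (fun z : Cplx R => oapp f 0 (insub z : option (upper R))) (val t : Cplx R) 1.

Definition holomorphic_infty f :=
  exists (h : nat) (a : nat -> Cplx R), (0 < h)%N /\
    forall t, series (fun n => a n * qpow (n%:R / h%:R) t) @ \oo --> f t.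

Definition SL2Z : set 'M[int]_2 := [set A : 'M[int]_2 | \det A = 1].

Definition Gamma (N : nat) : set 'M[int]_2 :=
  [set A : 'M[int]_2 | \det A = 1 /\
    forall i j, (A i j = (1%:M : 'M[int]_2) i j %[mod N])%Z].

Definition Gamma1 (N : nat) : set 'M[int]_2 :=
  [set A : 'M[int]_2 | [/\ \det A = 1, (A 0%R 0%R = 1 %[mod N])%Z,
    (A 1%R 1%R = 1 %[mod N])%Z & (A 1%R 0%R = 0 %[mod N])%Z]].

(* Holomorphy at the cusps is that of f|A at infinity for every A in SL_2(Z);
   the width h of the expansion may depend on A. *)
Definition modform (k : nat) (G : set 'M[int]_2) : set (upper R -> Cplx R) :=
  [set f | [/\ holomorphic f, forall A, G A -> slash k A f = f &
    forall A, SL2Z A -> holomorphic_infty (slash k A f)]].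

(* M_{k,r}(Gamma(p)): the forms g with g in q^(r/p) C[[q]], r modulo p. *)
Definition modform_res (k p : nat) (r : int) : set (upper R -> Cplx R) :=
  [set g | modform k (Gamma p) g /\ exists a : nat -> Cplx R, forall t,
    series (fun n => qpow ((r %% p)%Z%:~R / p%:R) t * (a n * qpow n%:R t))
      @ \oo --> g t].

End ModularForms.

Arguments modform R k G : clear implicits.
Arguments modform_res R k p r : clear implicits.

(* Internal direct sum: the sum map from the product of the W i to V is
   bijective. *)
Definition is_direct_sum (K : pzRingType) (E : lmodType K) (I : finType)
    (V : set E) (W : I -> set E) :=
  [/\ GRing.submod_closed [in V], forall i, GRing.submod_closed [in W i] &
    set_bij [set w : I -> E | forall i, W i (w i)] V (fun w => \sum_i w i)].

Definition linear_iso (K : pzRingType) (E : lmodType K) (V W : set E) :=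
  [/\ GRing.submod_closed [in V], GRing.submod_closed [in W] &
    exists phi : E -> E, set_bij V W phi /\
      forall (a : K) u v, V u -> V v -> phi (a *: u + v) = a *: phi u + phi v].

Definition legendre (a : int) (p : nat) : int :=
  if (p %| a)%Z then 0
  else if [exists x : 'I_p, ((x : int) ^+ 2 == a %[mod p])%Z] then 1 else -1.

(* Main.v *)
Require Import Defs.
From HB Require Import structures.
From mathcomp Require Import all_boot all_order all_algebra all_fingroup.
From mathcomp Require Import all_classical all_reals all_analysis.
From mathcomp Require Import complex ring lra.

Set Implicit Arguments.
Unset Strict Implicit.
Unset Printing Implicit Defensive.

Import Order.TTheory GRing.Theory Num.Theory numFieldNormedType.Exports.

Local Open Scope classical_set_scope.
Local Open Scope ring_scope.

(** The index r of M_(k,r) is an eigenvalue. Translation by 1 multiplies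
q^(r/p + n) by the root of unity exp (2 pi i r / p) for every n, so a form of
M_(k,r) is an eigenvector of it (res_eigen). Conversely, let f be a form for
Gamma(p) that is such an eigenvector, with an expansion of some width at
infinity. Averaging the translates of f against the conjugate character gives
back f, and annihilates each term of the expansion whose exponent is not in
r/p + Z (eigen_expansion, eigen_res).

The direct sum is then the decomposition of M_k(Gamma(p)) under a cyclic group
of order p: the slash operator of T = (1 1; 0 1) preserves M_k(Gamma(p)),
because Gamma(p) is normal in SL_2(Z) (modform_slash), and T^p is in Gamma(p).
The projections are the usual averages res_proj. For r = 0 the eigenvalue is
1, and Gamma_1(p) is generated by Gamma(p) and T (res0_Gamma1).

For the isomorphisms, let A in Gamma_0(p) have upper left entry a. Modulo p, A
is upper triangular with diagonal (a, a^-1), so A T is T^(a^2) A up to an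
element of Gamma(p), and the slash operator of A maps M_(k,r) to M_(k, r a^2)
(res_slash); the one of A^-1 is its inverse (res_iso). So the isomorphism
class of M_(k,r) depends only on the class of r modulo nonzero squares. A
nonzero square is in the class of 1; a nonsquare is an odd power of the
generator alpha, hence in the class of alpha^-1. *)

(** * The characters x |-> exp (2 pi i x) *)

Lemma sum_root_of_unity (K : idomainType) (N : nat) (w : K) :
  w ^+ N = 1 -> \sum_(j < N) w ^+ j = (w == 1)%:R * N%:R.
Proof.
move=> wN; case: eqP => [->|/eqP w1].
  under eq_bigr do rewrite expr1n.
  by rewrite sumr_const card_ord mul1r.
rewrite mul0r; apply/eqP; rewrite -(mulrI_eq0 _ (mulfI (_ : w - 1 != 0))).
  by rewrite -subrX1 wN subrr.
by rewrite subr_eq0.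
Qed.

Section Characters.
Variable R : realType.
Implicit Types (x y : R) (z w : R[i]) (t : upper R).

Definition exp2pi x : R[i] := cexp (Complex 0 (2 * pi * x)).

Lemma cexpD z w : cexp (z + w) = cexp z * cexp w :> R[i].
Proof.
case: z => a b; case: w => c d; rewrite /cexp /=; simpc.
by rewrite cosD sinD expRD; congr Complex; ring.
Qed.

Lemma cexp0 : cexp 0 = 1 :> R[i].
Proof. by rewrite /cexp /= expR0 cos0 sin0; simpc. Qed.

Lemma exp2piD x y : exp2pi (x + y) = exp2pi x * exp2pi y.
Proof. by rewrite /exp2pi -cexpD mulrDr; congr cexp; simpc. Qed.

Lemma exp2pi0 : exp2pi 0 = 1.
Proof. by rewrite /exp2pi mulr0 cexp0. Qed.

Lemma exp2piX x n : exp2pi (x * n%:R) = exp2pi x ^+ n.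
Proof.
elim: n => [|n IHn]; first by rewrite mulr0 exp2pi0.
by rewrite exprS -IHn -exp2piD -natr1 mulrDr mulr1 addrC.
Qed.

Lemma exp2piN x : exp2pi (- x) * exp2pi x = 1.
Proof. by rewrite -exp2piD addNr exp2pi0. Qed.

Lemma exp2pi_nat n : exp2pi n%:R = 1.
Proof.
rewrite -[n%:R]mul1r exp2piX /exp2pi /cexp /= expR0 mulr1.
rewrite mulr_natl cos2pi sin2pi.
by rewrite (_ : _ * _ = 1) ?expr1n//; simpc.
Qed.

Lemma exp2pi_int (n : int) : exp2pi n%:~R = 1.
Proof.
case: n => n; first exact: exp2pi_nat.
rewrite NegzE mulrNz; have := exp2piN n.+1%:R; rewrite exp2pi_nat mulr1.
exact.
Qed.

Lemma qpowD x y t : qpow (x + y) t = qpow x t * qpow y t :> R[i].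
Proof.
rewrite /qpow -cexpD; congr cexp.
by rewrite -mulrDl; congr (_ * _); simpc; rewrite mulrDr.
Qed.

(** The real part is 1 - 2 sin^2 (pi x), and sin (pi x) > 0 for 0 < x < 1. *)
Lemma exp2pi_eq1 x : 0 <= x < 1 -> exp2pi x = 1 -> x = 0.
Proof.
move=> /andP[x0 x1]; rewrite /exp2pi /cexp /= expR0; simpc => -[].
have -> : 2 * pi * x = (pi * x) *+ 2 by ring.
rewrite cos_mulr2n cos2sin2 => cos1 _; apply/eqP/contraT => xn0.
have : 0 < sin (pi * x).
  apply: sin_gt0_pi; rewrite mulr_gt0 ?pi_gt0 ?lt0r ?xn0//=.
  by rewrite gtr_pMr ?pi_gt0.
have : sin (pi * x) ^+ 2 = 0 by move: cos1; set s := _ ^+ 2; lra.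
by move/eqP; rewrite sqrf_eq0 => /eqP ->; rewrite ltxx.
Qed.

End Characters.

(** * The action of 2 x 2 integer matrices *)

Definition mx2 (a b c d : int) : 'M[int]_2 :=
  \matrix_(i, j) if i == 0 then if j == 0 then a else b
                 else if j == 0 then c else d.

Lemma mx2P (A : 'M[int]_2) : A = mx2 (A 0 0) (A 0 1) (A 1 0) (A 1 1).
Proof.
apply/matrixP => i j; rewrite !mxE.
by case: (unliftP 0 i) => [i'|] ->; rewrite ?ord1;
  case: (unliftP 0 j) => [j'|] ->; rewrite ?ord1 //=;
  congr (A _ _); apply: val_inj.
Qed.

Lemma mx2E a b c d : (mx2 a b c d 0 0 = a) * (mx2 a b c d 0 1 = b) *
  (mx2 a b c d 1 0 = c) * (mx2 a b c d 1 1 = d).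
Proof. by rewrite !mxE. Qed.

Lemma mx2M a b c d a' b' c' d' : mx2 a b c d *m mx2 a' b' c' d' =
  mx2 (a * a' + b * c') (a * b' + b * d') (c * a' + d * c') (c * b' + d * d').
Proof.
rewrite [LHS]mx2P; congr mx2; rewrite !mxE !big_ord_recl big_ord0 addr0;
by rewrite !mxE.
Qed.

Lemma det_mx2 a b c d : \det (mx2 a b c d) = a * d - b * c.
Proof.
rewrite (expand_det_row _ 0) !big_ord_recl big_ord0 addr0 /cofactor !det_mx11.
by rewrite !mxE /= expr0 expr1 mul1r mulN1r mulrN.
Qed.

Section Action.
Variable R : realType.
Implicit Types (f g : upper R -> Cplx R) (A B : 'M[int]_2) (t : upper R).

Lemma intC (n : int) : n%:~R = Complex n%:~R 0 :> R[i].
Proof. by rewrite -(rmorph_int (real_complex R)). Qed.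

Lemma val_moebius A t : \det A = 1 -> val (moebius_act A t) = moebius A t.
Proof. by move=> dA; rewrite /moebius_act insubdK//; exact: moebius_upper. Qed.

(** A quotient with positive imaginary part has a nonzero denominator, because
division by 0 gives 0. *)
Lemma autfactor_neq0 A t : \det A = 1 -> autfactor A t != 0.
Proof.
move=> dA; have := moebius_upper t dA; rewrite /moebius.
by apply: contraTneq => ->; rewrite invr0 mulr0 /= ltxx.
Qed.

Lemma autfactorM A B t : \det B = 1 ->
  autfactor (A *m B) t = autfactor A (moebius_act B t) * autfactor B t.
Proof.
move=> dB; have := autfactor_neq0 t dB.
rewrite [autfactor (_ *m _) t]/autfactor [autfactor A _]/autfactor.
rewrite val_moebius // /moebius (mx2P A) (mx2P B) mx2M !mx2E /autfactor !mx2E.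
move=> n0.
by field.
Qed.

Lemma moebius_actM A B t : \det A = 1 -> \det B = 1 ->
  moebius_act (A *m B) t = moebius_act A (moebius_act B t).
Proof.
move=> dA dB; apply: val_inj.
have n1 := autfactor_neq0 (moebius_act B t) dA.
have n2 := autfactor_neq0 t dB.
rewrite !val_moebius ?det_mulmx ?dA ?dB ?mulr1 // /moebius autfactorM //.
rewrite val_moebius // [in RHS]/moebius invfM [_^-1 * _^-1]mulrC [LHS]mulrA.
congr (_ / _); move: n2; rewrite (mx2P A) (mx2P B) mx2M /autfactor !mx2E => n2.
by field.
Qed.

Lemma slashM k A B f : \det A = 1 -> \det B = 1 ->
  slash k (A *m B) f = slash k B (slash k A f).
Proof.
move=> dA dB; apply/funext => t; rewrite /slash moebius_actM // autfactorM //.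
by rewrite exprMn invfM mulrA [(autfactor A _ ^- k * _)]mulrC.
Qed.

Lemma slash_linear k A (a : R[i]) f g :
  slash k A (a *: f + g) = a *: slash k A f + slash k A g.
Proof.
apply/funext => t; rewrite /slash !fctE mulrDr; congr (_ + _).
exact: mulrCA.
Qed.

Definition Tmx (j : int) := mx2 1 j 0 1.

Lemma Tmx0 : Tmx 0 = 1%:M.
Proof. by rewrite [RHS]mx2P !mxE. Qed.

Lemma det_Tmx j : \det (Tmx j) = 1.
Proof. by rewrite det_mx2 mulr1 mulr0 subr0. Qed.

Lemma val_Tmx j t : val (moebius_act (Tmx j) t) = val t + j%:~R.
Proof.
rewrite val_moebius ?det_Tmx // /moebius /autfactor !mx2E.
by rewrite mul0r add0r divr1 mul1r.
Qed.

Lemma slash_Tmx k j f t : slash k (Tmx j) f t = f (moebius_act (Tmx j) t).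
Proof.
rewrite /slash /autfactor !mx2E mul0r add0r expr1n invr1; exact: mul1r.
Qed.

End Action.

(** * Slash operators preserve holomorphy *)

(** The product, quotient and chain rules behind the slash operator, on the
regular module K^o, the form in which holomorphy is tested. *)
Lemma derivable_weight_action (K : numFieldType) (F : K^o -> K^o)
    (a b c d x : K^o) (k : nat) :
  c * x + d != 0 -> derivable F ((a * x + b) / (c * x + d)) 1 ->
  derivable (fun z : K^o =>
    (c * z + d) ^- k * F ((a * z + b) / (c * z + d)) : K^o) x 1.
Proof.
move=> den0 dF.
have affine (u v : K^o) : derivable (fun z : K^o => u * z + v : K^o) x 1.
  have uz : derivable (fun z : K^o => u * z : K^o) x 1.
    apply: (@derivableM _ _ (cst u) id); first exact: derivable_cst.
    exact: derivable_id.
  by apply: (@derivableD _ _ _ _ (cst v) _ _ uz); exact: derivable_cst.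
have dV : derivable (fun z : K^o => (c * z + d)^-1 : K^o) x 1.
  exact (@derivableV K K^o (fun z => c * z + d) x 1 den0 (affine c d)).
have dVX : derivable (fun z : K^o => (c * z + d) ^- k : K^o) x 1.
  elim: k => [|k IHk].
    rewrite (_ : (fun z => _) = cst 1); first exact: derivable_cst.
    by apply/funext => z; rewrite expr0 invr1.
  rewrite (_ : (fun z => _) =
      (fun z : K^o => (c * z + d)^-1) * (fun z : K^o => (c * z + d) ^- k)).
    exact (@derivableM K K^o _ _ x 1 dV IHk).
  by apply/funext => z; rewrite exprS invfM.
pose m (z : K^o) : K^o := (a * z + b) / (c * z + d).
have dm : derivable m x 1 by exact (@derivableM K K^o _ _ x 1 (affine a b) dV).
have dFm : derivable (F \o m) x 1.
  apply/derivable1_diffP; apply: differentiable_comp.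
      exact/(@derivable1_diffP K K^o).
    exact/(@derivable1_diffP K K^o).
exact (@derivableM K K^o _ _ x 1 dVX dFm).
Qed.

Section Holomorphy.
Variable R : realType.
Implicit Types (f g : upper R -> Cplx R) (A : 'M[int]_2) (t : upper R).

Let ext f (z : Cplx R) : Cplx R := oapp f 0 (insub z : option (upper R)).

Let ext_upper f (z : Cplx R) (z0 : 0 < complex.Im z) :
  ext f z = f (exist _ (z : R[i]) z0 : upper R).
Proof.
rewrite /ext; case: insubP => [u _ uz /=|]; last by rewrite z0.
by congr f; apply: val_inj.
Qed.

(** The open disc around t of radius Im t stays in the upper half-plane. *)
Lemma near_upper t :
  \forall z \near (val t : Cplx R), 0 < complex.Im (z : R[i]).
Proof.
case: t => t t0 /=; apply/nbhs_normP.
exists (complex.Im t)%:C%C; first by rewrite /= ltcR.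
move=> z /=; rewrite normc_def ltcR => tz.
have : `|complex.Im t - complex.Im z| < complex.Im t.
  apply: le_lt_trans tz; rewrite -sqrtr_sqr ler_wsqrtr//.
  case: t t0 => a b _; case: z => c d /=.
  by rewrite lerDr sqr_ge0.
by rewrite ltr_norml => /andP[_]; rewrite ltrBlDr ltrDl.
Qed.

Lemma holomorphic_linear (a : R[i]) f g :
  holomorphic f -> holomorphic g -> holomorphic (a *: f + g).
Proof.
move=> hf hg t.
have -> : (fun z : Cplx R => oapp (a *: f + g) 0 (insub z : option (upper R))) =
   (cst a * ext f) + ext g.
  apply/funext => z; rewrite /ext !fctE /=; case: insubP => [u _ _|_] //=.
  by rewrite mulr0 addr0.
apply: derivableD; last exact: hg.
apply: derivableM; [exact: derivable_cst | exact: hf].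
Qed.

Lemma holomorphic_slash k A f :
  \det A = 1 -> holomorphic f -> holomorphic (slash k A f).
Proof.
move=> dA hf t.
have den0 := autfactor_neq0 t dA.
have := @derivable_weight_action R[i] (ext f) (A 0 0)%:~R (A 0 1)%:~R
  (A 1 0)%:~R (A 1 1)%:~R (val t) k den0.
rewrite -[(_ / _)]/(moebius A t) -(val_moebius t dA) => /(_ (hf _)).
apply: near_eq_derivable.
(* The extension by 0 is only compared with the quotient near val t. *)
have := near_upper t; apply: filterS => z z0.
rewrite -/(ext (slash k A f) z) (ext_upper (slash k A f) z0) /slash.
congr (_ * _).
set s := exist _ _ _; rewrite [_ / _](_ : _ = val (moebius_act A s)).
  by rewrite /ext valK.
by rewrite val_moebius.
Qed.

End Holomorphy.

(** * Expansions at infinity *)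

Lemma cvg_series_linear (K : numFieldType) (a : K^o) (u v : nat -> K^o)
    (l m : K^o) :
  series u @ \oo --> l -> series v @ \oo --> m ->
  series (fun n => a * u n + v n) @ \oo --> a * l + m.
Proof.
move=> ul vm.
rewrite (_ : series _ = (fun n => a * series u n + series v n)).
  by apply: (@cvgD K K^o) => //; apply: (@cvgM K) => //; exact: cvg_cst.
apply/funext => n; rewrite /series /= mulr_sumr -big_split /=.
exact: eq_bigr.
Qed.

Lemma cvg_lincomb (K : numFieldType) (N : nat) (c : K^o) (b : nat -> K^o)
    (u : nat -> nat -> K^o) (l : nat -> K^o) :
  (forall j, u j @ \oo --> l j) ->
  (fun n => c * \sum_(j < N) b j * u j n) @ \oo --> c * \sum_(j < N) b j * l j.
Proof.
move=> ul; apply: (@cvgM K); first exact: cvg_cst.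
elim: N => [|N IHN].
  by under eq_fun do rewrite big_ord0; rewrite big_ord0; exact: cvg_cst.
under eq_fun do rewrite big_ord_recr /=; rewrite big_ord_recr /=.
apply: (@cvgD K K^o) => //; apply: (@cvgM K) => //; exact: cvg_cst.
Qed.

Section Expansions.
Variable R : realType.
Implicit Types (x : R) (f g : upper R -> Cplx R) (t : upper R).

Lemma qpow_Tmx x j t :
  qpow x (moebius_act (Tmx j) t) = exp2pi (x * j%:~R) * qpow x t :> R[i].
Proof.
rewrite /qpow /exp2pi -cexpD val_Tmx; congr cexp; rewrite intC.
by case: (val t) => a b; simpc; congr Complex; ring.
Qed.

Lemma cvgy_leq_mul (c : nat -> nat) (m : nat) :
  (forall n, n <= m * c n)%N -> c @ \oo --> \oo.
Proof.
move=> cm; apply/cvgnyPge => K.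
near=> n; have : (m * K < n)%N by near: n; exact: nbhs_infty_gt.
move=> /leq_trans /(_ (cm n)); rewrite ltn_mul2l => /andP[_ /ltnW]; exact.
Unshelve. all: by end_near. Qed.

(** Spreading the terms with step m, with zeros between them, repeats each
partial sum, so that the series keeps its limit: an expansion of width h is also
one of width h m. *)
Lemma series_dilate (m : nat) (u : nat -> Cplx R) (l : Cplx R) : (0 < m)%N ->
  series u @ \oo --> l ->
  series (fun n => if (m %| n)%N then u (n %/ m)%N else 0) @ \oo --> l.
Proof.
move=> m0 ul; pose c n := ((n + m.-1) %/ m)%N.
(* c n counts the multiples of m below n. *)
have cm n : (n <= m * c n)%N.
  rewrite mulnC -(leq_add2r m.-1) {1}(divn_eq (n + m.-1) m) leq_add2l.
  by rewrite -ltnS prednK // ltn_pmod.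
have -> : series (fun n => if (m %| n)%N then u (n %/ m)%N else 0) =
    series u \o c.
  apply/funext; elim => [|n IHn] /=.
    by rewrite /c add0n divn_small ?prednK // !seriesEnat /= !big_geq.
  rewrite /series /= in IHn *; rewrite big_nat_recr //= IHn /c.
  have -> : (n.+1 + m.-1 = (n + m.-1).+1)%N by rewrite addSn.
  rewrite divnS // -addnS prednK // dvdn_addl //; case: dvdnP => [[q ->]|_].
    rewrite mulnK // divnDl ?dvdn_mull // mulnK // divn_small ?prednK //.
    by rewrite addn0 add1n big_nat_recr.
  by rewrite add0n addr0.
exact: (cvg_comp _ _ (cvgy_leq_mul cm) ul).
Qed.

(** Two expansions of widths h1 and h2 are added at the common width h1 h2. *)
Lemma holomorphic_infty_linear (a : R[i]) f g :
  holomorphic_infty f -> holomorphic_infty g -> holomorphic_infty (a *: f + g).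
Proof.
move=> [h1 [u [h10 uf]]] [h2 [v [h20 vg]]].
pose dil m (w : nat -> Cplx R) : nat -> Cplx R :=
  fun n => if (m %| n)%N then w (n %/ m)%N else 0.
have nat0 m : (0 < m)%N -> m%:R != 0 :> R by rewrite pnatr_eq0 -lt0n.
have dilE (h m : nat) w f' : (0 < h)%N -> (0 < m)%N ->
    (forall t, series (fun n => w n * qpow (n%:R / h%:R) t) @ \oo --> f' t) ->
    forall t, series (fun n => dil m w n * qpow (n%:R / (h * m)%:R) t) @ \oo
      --> f' t.
  move=> h0 m0 wf t; have := series_dilate m0 (wf t).
  rewrite (_ : (fun n => _) =
    fun n => dil m w n * qpow (n%:R / (h * m)%:R) t) //.
  apply/funext => n; rewrite /dil.
  case: dvdnP => [[q ->]|_]; last by rewrite mul0r.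
  rewrite mulnK // !natrM -mulf_div divff ?mulr1 // nat0 //.
exists (h1 * h2)%N, (fun n => a * dil h2 u n + dil h1 v n).
split=> [|t]; first by rewrite muln_gt0 h10.
have U := dilE _ _ _ _ h10 h20 uf t.
have V := dilE _ _ _ _ h20 h10 vg t; rewrite mulnC in V.
have := @cvg_series_linear R[i] a _ _ _ _ U V.
rewrite (_ : (fun n => _) = fun n => (a * dil h2 u n + dil h1 v n) *
  qpow (n%:R / (h1 * h2)%:R) t) //.
by apply/funext => n; rewrite mulrDl mulrA.
Qed.

Lemma sum_blocks (h M : nat) (v : nat -> Cplx R) :
  series v (h * M)%N = series (fun m => \sum_(i < h) v (h * m + i)%N) M.
Proof.
elim: M => [|M IHM]; first by rewrite muln0 /series /= !big_geq.
rewrite /series /= in IHM *; rewrite big_nat_recr //= -IHM mulnS.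
rewrite (big_cat_nat (n := (h * M)%N)) //= ?leq_addl //; congr (_ + _).
rewrite -{1}[(h * M)%N]add0n big_addn addnK big_mkord.
by apply: eq_bigr => i _; rewrite addnC.
Qed.

Lemma TmxD i j : Tmx i *m Tmx j = Tmx (i + j).
Proof. by rewrite mx2M; congr mx2; ring. Qed.

Lemma shift_eigen f x :
  (forall t, f (moebius_act (Tmx 1) t) = exp2pi x * f t) ->
  forall (j : nat) t, f (moebius_act (Tmx j) t) = exp2pi x ^+ j * f t.
Proof.
move=> fx; elim => [|j IHj] t.
  rewrite expr0 mul1r; congr f; apply: val_inj.
  by rewrite val_Tmx addr0.
rewrite exprS -mulrA -IHj -fx -moebius_actM ?det_Tmx //.
by rewrite TmxD -addn1 addrC.
Qed.

(** Let N = h p, a common period of the characters involved. Since f is an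
eigenvector of the translation by 1,
  f t = 1/N * \sum_(j < N) exp2pi (- x j) f (t + j).
Expanding each f (t + j) multiplies the term of exponent n / h by the mean of
the first N powers of exp2pi (n / h - x), which is 1 if n / h - x is an
integer and 0 otherwise. So the terms of the expansion of f whose exponent is
not in x + Z can be dropped. In a block h m <= n < h (m + 1) at most the
exponent x + m remains. *)
Lemma eigen_expansion f x : 0 <= x < 1 -> holomorphic_infty f ->
  (exists2 p : nat, (0 < p)%N & exp2pi x ^+ p = 1) ->
  (forall t, f (moebius_act (Tmx 1) t) = exp2pi x * f t) ->
  exists b : nat -> Cplx R, forall t,
    series (fun n => qpow x t * (b n * qpow n%:R t)) @ \oo --> f t.
Proof.
move=> x01 [h [a [h0 af]]] [p p0 xp] fx.
have hR0 : h%:R != 0 :> R by rewrite pnatr_eq0 -lt0n.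
exists (fun m => \sum_(i < h | i%:R / h%:R == x) a (h * m + i)%N) => t.
pose N := (h * p)%N.
have N0 : N%:R != 0 :> R[i] by rewrite pnatr_eq0 -lt0n muln_gt0 h0.
pose w (n : nat) : R[i] := exp2pi (n%:R / h%:R - x).
have xN : exp2pi x ^+ N = 1 by rewrite /N mulnC exprM xp expr1n.
have nxN : exp2pi (- x) ^+ N = 1.
  by rewrite -[LHS]mulr1 -[X in _ * X]xN -exprMn exp2piN expr1n.
have wN n : w n ^+ N = 1.
  rewrite /w exp2piD exprMn nxN mulr1 -exp2piX /N natrM mulrA divfK //.
  by rewrite -natrM exp2pi_nat.
pose v n : Cplx R := (w n == 1)%:R * (a n * qpow (n%:R / h%:R) t).
have vf : series v @ \oo --> f t.
  pose u j n : Cplx R :=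
    a n * qpow (n%:R / h%:R) (moebius_act (Tmx (Posz j)) t).
  have uf j : series (u j) @ \oo --> (exp2pi x ^+ j * f t : Cplx R).
    by rewrite -(shift_eigen fx); exact: af.
  have := @cvg_lincomb R[i] N N%:R^-1 (fun j => exp2pi (- x) ^+ j) _ _ uf.
  have -> : \sum_(j < N) exp2pi (- x) ^+ j * (exp2pi x ^+ j * f t) = N%:R * f t.
    under eq_bigr do rewrite mulrA -exprMn exp2piN expr1n mul1r.
    by rewrite sumr_const card_ord mulr_natl.
  rewrite mulKf //.
  rewrite (_ : (fun n => _) = series v) //; apply/funext => M.
  under eq_bigr do rewrite mulr_sumr.
  rewrite exchange_big /= mulr_sumr; apply: eq_bigr => n _.
  have uE (j : 'I_N) : exp2pi (- x) ^+ j * u j n =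
      w n ^+ j * (a n * qpow (n%:R / h%:R) t).
    rewrite /u qpow_Tmx /w exp2piD [in RHS]exprMn -exp2piX mulrCA [RHS]mulrC.
    rewrite -[RHS]mulrA; congr (_ * _).
    rewrite -pmulrn mulrCA mulrA.
    by rewrite !exp2piX [RHS]mulrC.
  rewrite (eq_bigr _ (fun j _ => uE j)) -mulr_suml sum_root_of_unity //.
  by rewrite /v [_ * N%:R]mulrC -mulrA mulKf.
have -> : (fun n => qpow x t *
    ((\sum_(i < h | i%:R / h%:R == x) a (h * n + i)%N) * qpow n%:R t)) =
    fun m => \sum_(i < h) v (h * m + i)%N.
  apply/funext => m.
  rewrite big_mkcond /= mulr_suml mulr_sumr; apply: eq_bigr => i _.
  have hmi : (h * m + i)%:R / h%:R = m%:R + i%:R / h%:R :> R.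
    by rewrite natrD natrM mulrDl mulrAC divff // mul1r.
  rewrite /v /w hmi -addrA exp2piD exp2pi_nat mul1r.
  have -> : (exp2pi (i%:R / h%:R - x) == 1) = (i%:R / h%:R == x).
    (* Both numbers lie in [0, 1), so their difference is below 1 in size. *)
    apply/eqP/eqP => [|->]; last by rewrite subrr exp2pi0.
    have i0 : 0 <= i%:R / h%:R :> R by rewrite divr_ge0.
    have i1 : i%:R / h%:R < 1 :> R.
      by rewrite ltr_pdivrMr ?ltr0n // mul1r ltr_nat.
    have [xi|ix] := leP x (i%:R / h%:R) => e1.
      by apply/eqP; rewrite -subr_eq0; apply/eqP/exp2pi_eq1 => //; lra.
    have := exp2piN (i%:R / h%:R - x); rewrite e1 mulr1 opprB => e1'.
    by apply/esym/eqP; rewrite -subr_eq0; apply/eqP/exp2pi_eq1 => //; lra.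
  case: eqP => [->|_]; last by rewrite !mul0r mulr0.
  by rewrite qpowD mul1r mulrC mulrA.
have c1 n : (n <= 1 * (h * n))%N by rewrite mul1n leq_pmull.
rewrite (_ : series _ = series v \o muln h).
  exact: cvg_comp (cvgy_leq_mul c1) vf.
by apply/funext => M; rewrite /= sum_blocks.
Qed.

End Expansions.

(** * Congruence subgroups and the spaces of modular forms *)

Section Congruence.
Implicit Types (A B : 'M[int]_2) (N : nat).

(** This form of the congruences is stable under conjugation. *)
Lemma GammaP N A : Gamma N A <->
  \det A = 1 /\ exists C, A = 1%:M + N%:Z *: C.
Proof.
split=> -[dA AN]; split=> //.
  exists (\matrix_(i, j) divz (A i j - (i == j)%:R) N).
  apply/matrixP => i j; have /eqP := AN i j; rewrite eqz_mod_dvd.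
  by rewrite !mxE => d; rewrite mulrC divzK // addrC subrK.
case: AN => C -> i j; apply/eqP; rewrite eqz_mod_dvd !mxE addrAC subrr add0r.
by rewrite dvdz_mulr.
Qed.

Lemma Gamma_mx2 N a b c d : a * d - b * c = 1 ->
  (N %| a - 1)%Z -> (N %| b)%Z -> (N %| c)%Z -> (N %| d - 1)%Z ->
  Gamma N (mx2 a b c d).
Proof.
move=> D Na Nb Nc Nd; split=> [|i j]; first by rewrite det_mx2.
apply/eqP; rewrite eqz_mod_dvd !mxE.
case: (unliftP 0 i) => [i'|] ->; rewrite ?ord1;
  case: (unliftP 0 j) => [j'|] ->; by rewrite ?ord1 //= ?subr0.
Qed.

Lemma Gamma_conj N A B : \det A = 1 -> Gamma N B ->
  Gamma N (A *m B *m invmx A).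
Proof.
move=> dA /GammaP[dB [C CE]].
have uA : A \in unitmx by rewrite unitmxE dA unitr1.
apply/GammaP; split.
  by rewrite !det_mulmx dB mulr1 det_inv dA invr1 mulr1.
exists (A *m C *m invmx A).
by rewrite CE mulmxDr mulmx1 mulmxDl mulmxV // -scalemxAr -scalemxAl.
Qed.

End Congruence.

Lemma submod_closed_set (K : pzRingType) (E : lmodType K) (V : set E) :
  V 0 -> (forall a u v, V u -> V v -> V (a *: u + v)) ->
  GRing.submod_closed [in V].
Proof.
move=> V0 VD; split=> [|a u v /set_mem Vu /set_mem Vv]; apply/mem_set => //.
exact: VD.
Qed.

Section Modular.
Variable R : realType.
Implicit Types (f g : upper R -> Cplx R) (A B : 'M[int]_2).
Variable k : nat.

HB.instance Definition _ A := @GRing.isLinear.Build R[i] (upper R -> Cplx R)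
  (upper R -> Cplx R) *:%R (slash k A) (@slash_linear R k A).

Lemma slashZ A (a : R[i]) f : slash k A (a *: f) = a *: slash k A f.
Proof. exact: linearZ. Qed.

Lemma slash1 f : slash k 1%:M f = f.
Proof.
rewrite -Tmx0; apply/funext => t; rewrite slash_Tmx; congr f; apply: val_inj.
by rewrite val_Tmx addr0.
Qed.

Lemma modform0 (G : set 'M[int]_2) : modform R k G 0.
Proof.
split=> [t|A _|A _]; rewrite ?linear0 //.
  rewrite (_ : (fun z => _) = cst 0); first exact: derivable_cst.
  by apply/funext => z; case: insub.
exists 1%N, (fun=> 0); split=> // t.
rewrite (_ : series _ = cst 0); first exact: cvg_cst.
by apply/funext => n; rewrite /series /= big1 // => i _; rewrite mul0r.
Qed.

Lemma modform_linear (G : set 'M[int]_2) (a : R[i]) f g :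
  modform R k G f -> modform R k G g -> modform R k G (a *: f + g).
Proof.
move=> [hf Gf cf] [hg Gg cg]; split=> [|A GA|A SA].
- exact: holomorphic_linear.
- by rewrite linearP /= Gf // Gg.
- rewrite linearP /=.
  by apply: holomorphic_infty_linear; [apply: cf | apply: cg].
Qed.

(** The form is invariant because Gamma(N) is normal in SL_2(Z). *)
Lemma modform_slash N A f : \det A = 1 ->
  modform R k (Gamma N) f -> modform R k (Gamma N) (slash k A f).
Proof.
move=> dA [hf Gf cf]; split=> [|B GB|B dB].
- exact: holomorphic_slash.
- have [dB _] := GB; rewrite -slashM //.
  have GC := Gamma_conj dA GB; have [dC _] := GC.
  have uA : A \in unitmx by rewrite unitmxE dA unitr1.
  by rewrite -(mulmxKV uA (A *m B)) slashM // Gf.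
- by rewrite -slashM //; apply: cf; rewrite /SL2Z /= det_mulmx dA dB mulr1.
Qed.

End Modular.

(** * Residue classes of exponents as eigenspaces of translations *)

Lemma series_lim_scale (K : numFieldType) (c : K^o) (u v : nat -> K^o)
    (l m : K^o) : series u @ \oo --> l -> series v @ \oo --> m ->
  (forall n, v n = c * u n) -> m = c * l.
Proof.
move=> ul vm uv; apply: (cvg_unique (@norm_hausdorff K K^o) vm).
rewrite (_ : series v = fun n => c * series u n).
  by apply: (@cvgM K) => //; exact: cvg_cst.
by apply/funext => n; rewrite /series /= mulr_sumr; exact: eq_bigr.
Qed.

Section Residues.
Variables (R : realType) (k p : nat).
Hypothesis p_gt0 : (0 < p)%N.
Implicit Types (f g : upper R -> Cplx R) (A B : 'M[int]_2) (r s j : int).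

Definition chi (n : int) : R[i] := exp2pi (n%:~R / p%:R).

Let pR0 : p%:R != 0 :> R.
Proof. by rewrite pnatr_eq0 -lt0n. Qed.

Lemma chiD r s : chi (r + s) = chi r * chi s.
Proof. by rewrite /chi intrD mulrDl exp2piD. Qed.

Lemma chi0 : chi 0 = 1.
Proof. by rewrite /chi mul0r exp2pi0. Qed.

Lemma chiX r n : chi r ^+ n = chi (r * n%:Z).
Proof. by rewrite /chi -exp2piX intrM -pmulrn mulrAC. Qed.

Lemma chi_dvd r : (p %| r)%Z -> chi r = 1.
Proof.
by case/dvdzP => q ->; rewrite /chi intrM -[p%:~R]pmulrn mulfK // exp2pi_int.
Qed.

Lemma chi_mod r s : (p %| r - s)%Z -> chi r = chi s.
Proof. by move/chi_dvd => rs; rewrite -[r](subrK s) chiD rs mul1r. Qed.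

Lemma chi_modz r : chi (r %% p)%Z = chi r.
Proof. by apply: chi_mod; rewrite -eqz_mod_dvd modz_mod. Qed.

Let modz_bounds r : 0 <= ((r %% p)%Z%:~R / p%:R : R) < 1.
Proof.
rewrite divr_ge0 ?ler0z ?modz_ge0 ?pnatr_eq0 -?lt0n //=.
by rewrite ltr_pdivrMr ?ltr0n // mul1r [p%:R]pmulrn ltr_int ltz_pmod.
Qed.

Lemma chi_eq1 r : (chi r == 1) = (p %| r)%Z.
Proof.
apply/eqP/idP => [|/chi_dvd //]; rewrite -chi_modz.
move=> /(exp2pi_eq1 (modz_bounds r))/eqP.
rewrite mulf_eq0 invr_eq0 (negPf pR0) orbF intr_eq0.
by move=> /eqP/dvdz_mod0P.
Qed.

Lemma sum_chi r : \sum_(j < p) chi (r * j%:Z) = (p %| r)%Z%:R * p%:R.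
Proof.
rewrite -chi_eq1 -sum_root_of_unity; last by rewrite chiX chi_dvd ?dvdz_mull.
by apply: eq_bigr => j _; rewrite chiX.
Qed.

(** Modulo 1, all exponents of the expansion of f are r/p. *)
Lemma res_eigen r j f : modform_res R k p r f ->
  slash k (Tmx j) f = chi (r * j) *: f.
Proof.
move=> [_ [a af]]; apply/funext => t; rewrite slash_Tmx.
apply: (@series_lim_scale R[i] _ _ _ _ _ (af t)
  (af (moebius_act (Tmx j) t))) => n.
rewrite !qpow_Tmx [n%:R]pmulrn -intrM exp2pi_int mul1r -mulrA.
rewrite [_%:~R / _ * _]mulrAC -intrM; congr (_ * _); apply: chi_mod.
by rewrite -mulrBl dvdz_mulr // -eqz_mod_dvd modz_mod.
Qed.

(** With res_eigen, this identifies M_(k,r) with an eigenspace of the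
translation by 1, the description on which all that follows rests. *)
Lemma eigen_res r f : modform R k (Gamma p) f ->
  slash k (Tmx 1) f = chi r *: f -> modform_res R k p r f.
Proof.
move=> Mf fr; split=> //.
have cf : holomorphic_infty f.
  by have [_ _ /(_ 1%:M)] := Mf; rewrite slash1; apply; rewrite /SL2Z /= det1.
apply: eigen_expansion => //.
  by exists p => //; rewrite -/(chi _) chiX chi_dvd ?dvdz_mull.
by move=> t; rewrite -(slash_Tmx k) fr -/(chi _) chi_modz.
Qed.

Lemma modform_res_submod r : GRing.submod_closed [in modform_res R k p r].
Proof.
apply: submod_closed_set => [|a f g fr gr].
  by apply: eigen_res; [exact: modform0 | rewrite linear0 scaler0].
have [Mf _] := fr; have [Mg _] := gr.
apply: eigen_res; first exact: modform_linear.
rewrite linearP /= (res_eigen _ fr) (res_eigen _ gr) mulr1.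
by rewrite scalerDr !scalerA mulrC.
Qed.

(** The projection to the eigenspace of r, for the group of order p that the
translations form modulo Gamma(p). *)
Definition res_proj r f : upper R -> Cplx R :=
  (p%:R^-1 : R[i]) *: \sum_(j < p) chi (- (r * j%:Z)) *: slash k (Tmx j%:Z) f.

Lemma res_proj_sum (w : 'I_p -> upper R -> Cplx R) (i : 'I_p) :
  (forall r : 'I_p, modform_res R k p r (w r)) ->
  res_proj i (\sum_r w r) = w i.
Proof.
move=> wr; rewrite /res_proj.
under eq_bigr => j _ do rewrite raddf_sum /= scaler_sumr.
rewrite exchange_big /= (bigD1 i) //= [X in _ + X]big1 ?addr0 => [|r ri].
  under eq_bigr => j _ do
    rewrite (res_eigen _ (wr i)) scalerA -chiD addNr chi0 scale1r.
  rewrite sumr_const card_ord -[w i *+ p]scaler_nat scalerA mulVf ?scale1r //.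
  by rewrite pnatr_eq0 -lt0n.
under eq_bigr => j _ do
    rewrite (res_eigen _ (wr r)) scalerA -chiD addrC -mulrBl.
rewrite -scaler_suml sum_chi -eqz_mod_dvd !modz_nat !modn_small //.
by rewrite eqz_nat (inj_eq val_inj) (negPf ri) mul0r scale0r.
Qed.

Lemma sum_res_proj f : \sum_(r < p) res_proj r f = f.
Proof.
rewrite -scaler_sumr exchange_big /=.
have -> : \sum_(j < p) \sum_(r < p)
    chi (- (r%:Z * j%:Z)) *: slash k (Tmx j%:Z) f =
    \sum_(j < p) ((p %| j)%:R * p%:R : R[i]) *: slash k (Tmx j%:Z) f.
  apply: eq_bigr => j _; rewrite -scaler_suml; congr (_ *: _).
  under eq_bigr => r _ do rewrite mulrC -mulNr.
  by rewrite sum_chi dvdzE abszN.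
rewrite (bigD1 (Ordinal p_gt0)) //= big1 ?addr0 => [|j j0].
  rewrite dvdn0 mul1r scalerA mulVf ?pnatr_eq0 -?lt0n // scale1r.
  by rewrite Tmx0 slash1.
rewrite gtnNdvd ?ltn_ord // ?mul0r ?scale0r // lt0n.
by apply: contraNneq j0 => j0; apply/eqP/val_inj.
Qed.

Lemma Tmx_Gamma : Gamma p (Tmx p%:Z).
Proof. by apply: Gamma_mx2; rewrite ?subrr ?dvdz0 // mulr1 mulr0 subr0. Qed.

(** Averaging over the translations makes the form an eigenvector, since the
translation by p acts trivially. *)
Lemma res_projP r f : modform R k (Gamma p) f ->
  modform_res R k p r (res_proj r f).
Proof.
move=> Mf.
have MZ a g : modform R k (Gamma p) g -> modform R k (Gamma p) (a *: g).
  move=> Mg; have := modform_linear a Mg (modform0 R k (Gamma p)).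
  by rewrite addr0.
apply: eigen_res.
  apply/MZ; elim/big_ind: _ => [|u v Mu Mv|j _]; first exact: modform0.
    by have := modform_linear 1 Mu Mv; rewrite scale1r.
  by apply: MZ; apply: modform_slash => //; exact: det_Tmx.
rewrite /res_proj slashZ raddf_sum /= scalerA mulrC -scalerA; congr (_ *: _).
pose F (j : nat) := chi (- (r * j%:Z)) *: slash k (Tmx j%:Z) f.
transitivity (\sum_(j < p) chi r *: F j.+1).
  apply: eq_bigr => j _; rewrite /F slashZ -slashM ?det_Tmx // TmxD scalerA.
  by rewrite -chiD -addn1 PoszD mulrDr mulr1 opprD addrCA subrr addr0.
rewrite -scaler_sumr; congr (_ *: _).
(* F has period p, so the shift of the index does not change the sum. *)
have Fp : F p = F 0%N.
  have [_ Gf _] := Mf; rewrite /F Tmx0 slash1 (Gf _ Tmx_Gamma) mulr0.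
  by congr (_ *: _); apply: chi_mod; rewrite oppr0 subr0 rpredN dvdz_mull.
have F0S : \sum_(j < p.+1) F j = F 0%N + \sum_(j < p) F j.+1.
  by rewrite big_ord_recl.
have FSp : \sum_(j < p.+1) F j = \sum_(j < p) F j + F p by rewrite big_ord_recr.
by apply: (addrI (F 0%N)); rewrite -F0S FSp Fp addrC.
Qed.

(** The translation T by 1 and the matrix A of Gamma_0(p) satisfy
A T = T^(a^2) B A with B in Gamma(p), where a is the upper left entry of A.
So the slash operator of A multiplies the index r by a^2. *)
Lemma res_slash r s (a b c d : int) f : a * d - b * c = 1 -> (p %| c)%Z ->
  (p %| r * a ^+ 2 - s)%Z ->
  modform_res R k p r f -> modform_res R k p s (slash k (mx2 a b c d) f).
Proof.
move=> D pc rs fr; have [Mf _] := fr; have [_ Gf _] := Mf.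
have dA : \det (mx2 a b c d) = 1 by rewrite det_mx2.
apply: eigen_res; first exact: modform_slash.
(* This is T^(- a^2) A T A^-1, computed with a d - b c = 1. *)
pose B := mx2 (1 - a * c + a ^+ 2 * c ^+ 2) (- (a ^+ 3 * c))
              (- c ^+ 2) (1 + a * c).
have GB : Gamma p B.
  apply: Gamma_mx2; first by ring.
  - rewrite (_ : _ - 1 = (a ^+ 2 * c - a) * c); last by ring.
    exact: dvdz_mull.
  - by rewrite rpredN dvdz_mull.
  - by rewrite rpredN dvdz_mull.
  - by rewrite addrC addKr dvdz_mull.
have [dB _] := GB.
have -> : slash k (Tmx 1) (slash k (mx2 a b c d) f) =
    slash k (mx2 a b c d) (slash k B (slash k (Tmx (a ^+ 2)) f)).
  rewrite -!slashM ?det_mulmx ?det_Tmx ?dA ?dB ?mulr1 //; congr slash.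
  rewrite !mx2M; congr mx2; try ring.
    by transitivity (a * (a * d - b * c) + b); [rewrite D|]; ring.
  by transitivity (c * (a * d - b * c) + d); [rewrite D|]; ring.
rewrite (res_eigen _ fr) !slashZ Gf //; congr (_ *: _); exact: chi_mod.
Qed.

(** By Bezout some matrix of Gamma_0(p) has upper left entry a, and its inverse
is in Gamma_0(p) as well; the two slash operators are inverse isomorphisms. *)
Lemma res_iso r s a : coprimez a p -> (p %| r * a ^+ 2 - s)%Z ->
  linear_iso (modform_res R k p r) (modform_res R k p s).
Proof.
move=> /coprimezP[[u b] /= ab] rs.
have D1 : a * u - (- b) * p%:Z = 1 by rewrite -ab; ring.
have D2 : u * a - b * (- p%:Z) = 1 by rewrite -ab; ring.
have pN : (p %| - p%:Z)%Z by rewrite rpredN.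
have sr : (p %| s * u ^+ 2 - r)%Z.
  have au : a * u = 1 - b * p by rewrite -ab; ring.
  rewrite (_ : _ - r = (r * b * (b * p - 2)) * p - (r * a ^+ 2 - s) * u ^+ 2).
    by apply: rpredB; [exact: dvdz_mull | exact: dvdz_mulr].
  rewrite (_ : (r * a ^+ 2 - s) * u ^+ 2 = r * (a * u) ^+ 2 - s * u ^+ 2).
    by rewrite au; ring.
  by ring.
have VW : mx2 a (- b) p u *m mx2 u b (- p%:Z) a = 1%:M.
  rewrite mx2M -Tmx0; congr mx2; rewrite -?ab; ring.
have WV : mx2 u b (- p%:Z) a *m mx2 a (- b) p u = 1%:M.
  rewrite mx2M -Tmx0; congr mx2; rewrite -?ab; ring.
split; [exact: modform_res_submod | exact: modform_res_submod |].
exists (slash k (mx2 a (- b) p u)); split; last first.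
  by move=> c v w _ _; exact: linearP.
split=> [f fr|f g _ _ fg|g gs].
- exact: res_slash D1 _ rs fr.
- by rewrite -[f](slash1 k) -[g](slash1 k) -VW !slashM ?det_mx2 // fg.
exists (slash k (mx2 u b (- p%:Z) a) g); first exact: res_slash D2 pN sr gs.
by rewrite -slashM ?det_mx2 // WV slash1.
Qed.

Lemma res_direct_sum : is_direct_sum (modform R k (Gamma p))
  (fun r : 'I_p => modform_res R k p r).
Proof.
split; first exact: submod_closed_set (modform0 R k _) (@modform_linear R k _).
  by move=> r; exact: modform_res_submod.
split=> [w wr|w w' /set_mem wr /set_mem wr' ww'|f Mf].
- elim/big_ind: _ => [|u v Mu Mv|r _]; first exact: modform0.
    by have := modform_linear 1 Mu Mv; rewrite scale1r.
  by have [] := wr r.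
- by apply/funext => r; rewrite -(res_proj_sum r wr) -(res_proj_sum r wr') ww'.
- exists (fun r : 'I_p => res_proj r f); last exact: sum_res_proj.
  by move=> r; exact: res_projP.
Qed.

(** The group Gamma_1(p) is generated by Gamma(p) and the translation by 1. *)
Lemma res0_Gamma1 : modform_res R k p 0 = modform R k (Gamma1 p).
Proof.
apply/seteqP; split=> f.
  move=> f0; have [[hf Gf cf] _] := f0; split=> // A [dA A0 A1 A10].
  pose B := Tmx (- A 0 1) *m A.
  have -> : A = Tmx (A 0 1) *m B by rewrite mulmxA TmxD subrr Tmx0 mul1mx.
  have dB : \det B = 1 by rewrite det_mulmx det_Tmx mul1r.
  rewrite slashM ?det_Tmx // (res_eigen _ f0) mul0r chi0 scale1r Gf //.
  have p_dvd (i j : 'I_2) : (A i j = 1 %[mod p])%Z -> (p %| A i j - 1)%Z.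
    by move=> Aij; rewrite -eqz_mod_dvd; apply/eqP.
  have p10 : (p %| A 1%R 0%R)%Z.
    by rewrite -[A 1 0]subr0 -eqz_mod_dvd; apply/eqP.
  move: dB; rewrite /B {2 4}(mx2P A) mx2M det_mx2 => dB; apply: Gamma_mx2 => //.
  - rewrite mul1r mulNr addrAC; apply: rpredB; first exact: p_dvd.
    exact: dvdz_mull.
  - rewrite mul1r mulNr -[X in X - _]mulr1 -mulrBr -opprB mulrN rpredN.
    by apply: dvdz_mull; exact: p_dvd.
  - by rewrite mul0r add0r mul1r.
  - by rewrite mul0r add0r mul1r; exact: p_dvd.
move=> [hf Gf cf]; apply: eigen_res.
  split=> // A [dA A1]; apply: Gf; split=> //; rewrite A1 !mxE //.
rewrite chi0 scale1r Gf //; split; rewrite ?det_Tmx ?mx2E //.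
Qed.

End Residues.

(** * Squares modulo p and the isomorphisms *)

(** The exponent is odd because even powers are squares. *)
Lemma odd_power (F : finFieldType) (alpha : {unit F}) (x : F) :
  <[alpha]>%g = [set: {unit F}]%SET -> x != 0 ->
  (forall y, x != y ^+ 2) -> exists m, x = val alpha ^+ (m * 2).+1.
Proof.
move=> gen x0 nsq; have ux : x \is a GRing.unit by rewrite unitfE.
have : FinRing.unit _ ux \in <[alpha]>%g by rewrite gen inE.
case/cycleP => i /(congr1 val); rewrite FinRing.val_unitX /= => xi.
exists i./2; rewrite xi muln2 -[in LHS](odd_double_half i).
case: (boolP (odd i)) => // i0; case/eqP: (nsq (val alpha ^+ i./2)).
by rewrite xi -exprM muln2 -[in LHS](odd_double_half i) (negPf i0).
Qed.

Section Squares.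
Variables (R : realType) (k p : nat).
Hypothesis p_prime : prime p.
Implicit Types (r s : int).

Let dvdFp (z : int) : (p %| z)%Z = (z%:~R == 0 :> 'F_p).
Proof. by rewrite (dvdz_pcharf (pchar_Fp p_prime)). Qed.

Lemma res_iso_Fp r s (a : 'F_p) : a != 0 -> s%:~R = r%:~R * a ^+ 2 ->
  linear_iso (modform_res R k p r) (modform_res R k p s).
Proof.
move=> a0 rs; have aE : (nat_of_ord a)%:Z%:~R = a by rewrite -pmulrn natr_Zp.
apply: (@res_iso R k p (prime_gt0 p_prime) r s (nat_of_ord a)).
  rewrite coprimezE coprime_sym prime_coprime //.
  by have := dvdFp (nat_of_ord a); rewrite aE (negPf a0) => /negbT.
by rewrite dvdFp rmorphB rmorphM rmorphXn /= aE rs subrr.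
Qed.

Lemma legendre_square r : legendre r p = 1 ->
  exists2 x : 'F_p, x != 0 & r%:~R = x ^+ 2.
Proof.
rewrite /legendre dvdFp; case: ifP => // r0; case: ifP => // /existsP[x].
rewrite eqz_mod_dvd dvdFp rmorphB rmorphXn /= subr_eq0 => /eqP xr _.
exists (nat_of_ord x)%:~R => //; apply: contraFneq r0 => x0.
by rewrite -xr x0 expr0n.
Qed.

Lemma legendre_nonsquare r : legendre r p = -1 ->
  r%:~R != 0 :> 'F_p /\ forall x : 'F_p, r%:~R != x ^+ 2.
Proof.
rewrite /legendre dvdFp; case: ifP => // r0; case: ifP => // rx _.
split=> // x; apply: contraFneq rx => rx; apply/existsP.
exists (cast_ord (Fp_cast p_prime) x) => /=.
by rewrite eqz_mod_dvd dvdFp rmorphB rmorphXn /= -pmulrn natr_Zp rx subrr.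
Qed.

End Squares.

Theorem lemma5p4 (R : realType) (p k : nat) (p_prime : prime p)
    (p_ge5 : (5 <= p)%N) (k_gt0 : (0 < k)%N) :
  [/\ is_direct_sum (modform R k (Gamma p))
        (fun r : 'I_p => modform_res R k p r),
      modform_res R k p 0 = modform R k (Gamma1 p) &
      forall (alpha : {unit 'F_p}) (talpha : int),
        <[alpha]>%g = [set: {unit 'F_p}]%SET ->
        talpha%:~R = (val alpha)^-1 :> 'F_p ->
        (forall r : int, legendre r p = 1 ->
           linear_iso (modform_res R k p r) (modform_res R k p 1)) /\
        (forall r : int, legendre r p = -1 ->
           linear_iso (modform_res R k p r) (modform_res R k p talpha))].
Proof.
have p_gt0 := prime_gt0 p_prime.
split; [exact: res_direct_sum | exact: res0_Gamma1 |].
move=> alpha talpha gen talphaE; split=> r.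
  case/(legendre_square p_prime) => x x0 rx.
  apply: (@res_iso_Fp R k p p_prime r 1 x^-1); first by rewrite invr_eq0.
  by rewrite rx exprVn mulfV // expf_neq0.
case/(legendre_nonsquare p_prime) => r0 nsq.
(* If r = alpha^(2m+1), then alpha^-1 = r (alpha^-(m+1))^2. *)
have [m rE] := odd_power gen r0 nsq.
have a0 : val alpha != 0 :> 'F_p by rewrite -unitfE; exact: valP alpha.
apply: (@res_iso_Fp R k p p_prime r talpha (val alpha ^- m.+1)).
  by rewrite invr_eq0 expf_neq0.
rewrite talphaE rE exprVn -exprM mulSn addSn add1n [_ ^+ _.+2]exprS invfM.
by rewrite mulrCA mulfV ?mulr1 // expf_neq0.
Qed.
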